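(* Let $P\in\mathbb{C}[x,y]$ have no zeros in $\mathbb{R}\times\mathbb{H}$ and no factors in common with $\bar P$, let $M=\mathrm{Ord}(P(0,y))$, and normalize $P$ so that the coefficient of $y^M$ in $P(0,y)$ is real. Let $(2L_j,q_j)$, $j=1,\dots,M$, be the data from the factorization of $P$ described in the context, and let $A=\tfrac12(P+\bar P)$, $B=\tfrac1{2i}(P-\bar P)$. Then for all but finitely many $t\in\mathbb{R}$ there is a local factorization $$A(x,y)+tB(x,y)=u(x,y;t)\prod_{j=1}^{M}\bigl(y+q_j(x)+x^{2L_j}\psi_j(x;t)\bigr)$$ where, for each fixed such $t$, $u(\cdot,\cdot;t)\in\mathbb{C}\{x,y\}$ is a unit and $\psi_j(\cdot;t)\in\mathbb{R}\{x\}$, and moreover for all $i\neq j$, $$\mathrm{Ord}\bigl(q_j(x)-q_i(x)+x^{2L_j}\psi_j(x;t)-x^{2L_i}\psi_i(x;t)\bigr)=O_{ij}.$$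
   Context: $\mathbb{H}=\{\operatorname{Im}z>0\}$; $\bar P(x,y)=\overline{P(\bar x,\bar y)}$. $\mathbb{C}\{x,y\}$ denotes convergent power series at the origin, $\mathbb{R}\{x\}$ those in $x$ with real coefficients; a unit is a series nonvanishing at the origin; Ord is order of vanishing at $0$. For such $P$ one has (locally) $P=u\prod_{j=1}^M(y+q_j(x)+x^{2L_j}\psi_j(x^{1/k}))$ with $u$ a unit, $k\ge1$, $L_j\in\mathbb{N}$, $q_j\in\mathbb{R}[x]$, $q_j(0)=0$, $\deg q_j<2L_j$, $\psi_j\in\mathbb{C}\{x\}$, $\operatorname{Im}\psi_j(0)>0$; the pairs $(2L_j,q_j)$ are these data. $O_{ij}=\min\{\mathrm{Ord}(q_j-q_i),2L_j,2L_i\}$. *)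

(* Defs.v *)
(* R : realType (from mathcomp-reals, a real closed field),
   C := R[i] from mathcomp-real-closed.  Convergent power series are
   represented by their coefficient families together with a convergence
   (geometric bound) predicate; identities in C{x,y} are identities of
   coefficient families under the (finite) Cauchy product. *)
From HB Require Import structures.
From mathcomp Require Import all_boot all_order all_algebra.
From mathcomp Require Import reals complex.
Set Implicit Arguments. Unset Strict Implicit. Unset Printing Implicit Defensive.
Import Order.TTheory GRing.Theory Num.Theory.
Local Open Scope ring_scope.

Section Series.
Variable R : realType.
Local Notation C := R[i].

(* formal power series in one variable x: coefficient of x^m *)
Definition ser1 (K : Type) := nat -> K.
(* formal power series in (x,y): coefficient of x^m y^n *)
Definition ser2 := nat -> nat -> C.

Definition conv1 (a : ser1 C) : Prop :=
  exists r K : R, 0 < r /\ forall m, `|a m| * (r%:C)%C ^+ m <= (K%:C)%C.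
Definition conv1R (a : ser1 R) : Prop :=
  exists r K : R, 0 < r /\ forall m, `|a m| * r ^+ m <= K.
Definition conv2 (a : ser2) : Prop :=
  exists r K : R, 0 < r /\ forall m n, `|a m n| * (r%:C)%C ^+ (m + n) <= (K%:C)%C.

Definition unit2 (u : ser2) : Prop := conv2 u /\ u 0%N 0%N != 0.

Definition mulS (f g : ser2) : ser2 := fun m n =>
  \sum_(i < m.+1) \sum_(j < n.+1) f i j * g (m - i)%N (n - j)%N.
Definition oneS : ser2 := fun m n => ((m == 0%N) && (n == 0%N))%:R.

Definition lin1 (h : ser1 C) : ser2 := fun m n =>
  if n == 1%N then (m == 0%N)%:R else if n == 0%N then h m else 0.

Definition shiftS (K : zmodType) (d : nat) (h : ser1 K) : ser1 K :=
  fun m => if (d <= m)%N then h (m - d)%N else 0.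
Definition substk1 (K : zmodType) (k : nat) (h : ser1 K) : ser1 K :=
  fun m => if (k %| m)%N then h (m %/ k)%N else 0.
Definition substk2 (k : nat) (f : ser2) : ser2 :=
  fun m n => if (k %| m)%N then f (m %/ k)%N n else 0.

Definition addS1 (K : zmodType) (a b : ser1 K) : ser1 K := fun m => a m + b m.

Definition realS (a : ser1 R) : ser1 C := fun m => ((a m)%:C)%C.
Definition polyS1 (q : {poly R}) : ser1 C := fun m => ((q`_m)%:C)%C.

(* P in C[x,y] is represented as P : {poly {poly C}}, P = sum_n P`_n(x) y^n *)
Definition polyS2 (P : {poly {poly C}}) : ser2 := fun m n => (P`_n)`_m.
Definition eval2 (P : {poly {poly C}}) (a b : C) : C :=
  (map_poly (fun p : {poly C} => p.[a]) P).[b].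
(* \bar P (x,y) = conj (P (conj x, conj y)) *)
Definition conjP (P : {poly {poly C}}) : {poly {poly C}} :=
  map_poly (map_poly (@conjc R)) P.
Definition cstP (c : C) : {poly {poly C}} := c%:P%:P.
Definition Apart (P : {poly {poly C}}) := cstP (2^-1) * (P + conjP P).
Definition Bpart (P : {poly {poly C}}) := cstP ((2 * 'i%C)^-1) * (P - conjP P).

Definition has_order (K : zmodType) (a : ser1 K) (n : nat) : Prop :=
  (forall m, (m < n)%N -> a m = 0) /\ a n != 0.

(* Ord of a polynomial (meaningful for q != 0) *)
Definition ordp (K : nzRingType) (q : {poly K}) : nat := find (fun c => c != 0) q.

(* O_ij = min {Ord(q_j - q_i), 2L_j, 2L_i}, with Ord 0 = +oo *)
Definition Oij (qi qj : {poly R}) (Li Lj : nat) : nat :=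
  if qj - qi == 0 then minn (2 * Lj) (2 * Li)
  else minn (ordp (qj - qi)) (minn (2 * Lj) (2 * Li)).

End Series.

(* Main.v *)
Require Import Defs.
From HB Require Import structures.
From mathcomp Require Import all_boot all_order all_algebra.
From mathcomp Require Import reals complex.
From mathcomp Require Import polyXY separable boolp.
From mathcomp Require Import ring lra zify.
Import Order.TTheory GRing.Theory Num.Theory.
Set Implicit Arguments. Unset Strict Implicit. Unset Printing Implicit Defensive.
Local Open Scope ring_scope.

(* Along y = - q_i(x) - z x^(2 L_i), with z real, the j-th factor of P has order
   O_ij and its lowest coefficient is psi_j(0) - z if (L_j, q_j) = (L_i, q_i),
   a real number minus z if q_j refines q_i to a higher order, and a nonzero
   constant otherwise.  So the lowest coefficient of P is c H(z) g(z) with H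
   having its roots in the upper half plane and g real-rooted, and that of
   A + t B is g(z) (Re + t Im)(c H(z)).  By Hermite-Biehler the latter factor
   has deg H simple real roots, and for all but finitely many t they avoid the
   roots of g.  Being simple, they lift by Hensel's lemma to convergent real
   series psi_j(x; t).  This produces M distinct power series roots of the
   polynomial A + t B of y-order M; dividing them out leaves a unit, and the
   contact orders are read off from the values psi_j(0; t). *)

(** * The ring of formal power series *)

(** A separate type carries the Cauchy product as its multiplication; the coercion still lets a
    series serve as a [ser1]. *)
Record fps (K : Type) := Fps { fcoef :> nat -> K }.

Lemma fpsP (K : Type) (f g : fps K) : (forall m, f m = g m) -> f = g.
Proof. by case: f g => [f] [g] /= fg; congr Fps; exact/funext. Qed.

HB.instance Definition _ (K : Type) := gen_eqMixin (fps K).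
HB.instance Definition _ (K : Type) := gen_choiceMixin (fps K).

Section FpsRing.
Variable K : comNzRingType.
Implicit Types f g h : fps K.

Definition fps_zero : fps K := Fps (fun=> 0).
Definition fps_one : fps K := Fps (fun m => (m == 0%N)%:R).
Definition fps_opp f : fps K := Fps (fun m => - f m).
Definition fps_add f g : fps K := Fps (fun m => f m + g m).
Definition fps_mul f g : fps K :=
  Fps (fun m => \sum_(i < m.+1) f i * g (m - i)%N).

Definition fps_trunc n f : {poly K} := \poly_(i < n) f i.

(** Each coefficient of a product involves finitely many coefficients of the factors, so
    commutativity and associativity are inherited from polynomials. *)
Lemma fps_mul_trunc n f g m : (m < n)%N ->
  fps_mul f g m = (fps_trunc n f * fps_trunc n g)`_m.
Proof.
move=> mn; rewrite coefM; apply: eq_bigr => i _.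
by rewrite !coef_poly; case: ltnP => [_|]; [case: ltnP => // | ]; have := ltn_ord i; lia.
Qed.

Lemma coefM_eq_low n (p p' r r' : {poly K}) :
  (forall i, (i < n)%N -> p`_i = p'`_i) ->
  (forall i, (i < n)%N -> r`_i = r'`_i) ->
  forall i, (i < n)%N -> (p * r)`_i = (p' * r')`_i.
Proof.
move=> hp hr i hi; rewrite !coefM; apply: eq_bigr => j _.
by rewrite hp ?hr //; have := ltn_ord j; lia.
Qed.

Fact fps_addA : associative fps_add.
Proof. by move=> f g h; apply: fpsP => m /=; rewrite addrA. Qed.
Fact fps_addC : commutative fps_add.
Proof. by move=> f g; apply: fpsP => m /=; rewrite addrC. Qed.
Fact fps_add0 : left_id fps_zero fps_add.
Proof. by move=> f; apply: fpsP => m /=; rewrite add0r. Qed.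
Fact fps_addN : left_inverse fps_zero fps_opp fps_add.
Proof. by move=> f; apply: fpsP => m /=; rewrite addNr. Qed.

HB.instance Definition _ :=
  GRing.isZmodule.Build (fps K) fps_addA fps_addC fps_add0 fps_addN.

Fact fps_mulC : commutative fps_mul.
Proof.
by move=> f g; apply: fpsP => m; rewrite !(@fps_mul_trunc m.+1) // mulrC.
Qed.

Fact fps_mulA : associative fps_mul.
Proof.
move=> f g h; apply: fpsP => m; rewrite !(@fps_mul_trunc m.+1) //.
have low u v i : (i < m.+1)%N ->
    (fps_trunc m.+1 (fps_mul u v))`_i = (fps_trunc m.+1 u * fps_trunc m.+1 v)`_i.
  by move=> im; rewrite coef_poly im (@fps_mul_trunc m.+1).
rewrite (coefM_eq_low (fun i _ => erefl) (low g h)) // mulrA.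
by apply: esym; apply: (coefM_eq_low (low f g)) => //.
Qed.

Fact fps_mul1 : left_id fps_one fps_mul.
Proof.
move=> f; apply: fpsP => m /=; rewrite big_ord_recl /= mul1r subn0.
by rewrite big1 ?addr0 // => i _; rewrite mul0r.
Qed.

Fact fps_mulDl : left_distributive fps_mul fps_add.
Proof.
move=> f g h; apply: fpsP => m /=; rewrite -big_split /=.
by apply: eq_bigr => i _; rewrite mulrDl.
Qed.

Fact fps_one_neq0 : fps_one != 0.
Proof. by apply/eqP => /(congr1 (fun f : fps K => f 0%N)) /eqP; rewrite oner_eq0. Qed.

HB.instance Definition _ := GRing.Zmodule_isComNzRing.Build (fps K)
  fps_mulA fps_mulC fps_mul1 fps_mulDl fps_one_neq0.

Lemma fps1E m : (1 : fps K) m = (m == 0%N)%:R. Proof. by []. Qed.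
Lemma fpsDE f g m : (f + g) m = f m + g m. Proof. by []. Qed.
Lemma fpsNE f m : (- f) m = - f m. Proof. by []. Qed.
Lemma fpsBE f g m : (f - g) m = f m - g m. Proof. by []. Qed.
Lemma fpsME f g m : (f * g) m = \sum_(i < m.+1) f i * g (m - i)%N.
Proof. by []. Qed.

Lemma fps_sumE (I : Type) (r : seq I) (P : pred I) (F : I -> fps K) m :
  (\sum_(i <- r | P i) F i) m = \sum_(i <- r | P i) F i m.
Proof. by apply: (big_morph (fun f : fps K => f m)). Qed.

(** Below index [m + n] every term of the Cauchy sum has a vanishing factor, and at [m + n] only the
    term [i = m] survives. As [f m] and [g n] may be zero, lower bounds on the orders suffice. *)
Lemma fpsM_low f g m n : (forall i, (i < m)%N -> f i = 0) ->
  (forall i, (i < n)%N -> g i = 0) ->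
  (forall i, (i < m + n)%N -> (f * g) i = 0) /\
  (f * g) (m + n)%N = f m * g n.
Proof.
move=> fm gn; split=> [i imn|].
  rewrite fpsME big1 // => j _; case: (ltnP j m) => jm.
    by rewrite fm // mul0r.
  by rewrite gn ?mulr0 //; have := ltn_ord j; lia.
have mlt : (m < (m + n).+1)%N by lia.
rewrite fpsME (bigD1 (Ordinal mlt)) //= addKn big1 ?addr0 // => j.
rewrite -val_eqE /= => jm; case: (ltngtP j m) jm => // jm _.
  by rewrite fm // mul0r.
by rewrite gn ?mulr0 //; have := ltn_ord j; lia.
Qed.

Definition fps_poly (p : {poly K}) : fps K := Fps (fun m => p`_m).

Fact fps_poly_is_zmod_morphism : zmod_morphism fps_poly.
Proof. by move=> p r; apply: fpsP => m /=; rewrite coefB. Qed.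
Fact fps_poly_is_monoid_morphism : monoid_morphism fps_poly.
Proof.
split; first by apply: fpsP => m; rewrite fps1E /= coef1.
by move=> p r; apply: fpsP => m; rewrite fpsME /= coefM.
Qed.
HB.instance Definition _ := GRing.isZmodMorphism.Build {poly K} (fps K)
  fps_poly fps_poly_is_zmod_morphism.
HB.instance Definition _ := GRing.isMonoidMorphism.Build {poly K} (fps K)
  fps_poly fps_poly_is_monoid_morphism.

End FpsRing.

Section FpsProd.
Variables (K : comNzRingType) (I : finType) (f : I -> fps K) (o : I -> nat).
Hypothesis f_low : forall i m, (m < o i)%N -> f i m = 0.

Lemma fps_prod_low :
  (forall m, (m < \sum_i o i)%N -> (\prod_i f i) m = 0) /\
  (\prod_i f i) (\sum_i o i) = \prod_i f i (o i).
Proof.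
elim/big_ind3: _ => [|x n a y l b [hx hx1] [hy hy1]|i _]; last first.
- by split=> // m /f_low.
- by have [h1 h2] := fpsM_low hx hy; split=> //; rewrite h2 hx1 hy1.
- by split.
Qed.
End FpsProd.

(** Once [g] vanishes below [m], the coefficient of index [n + m] in [f * g] is [f n * g m]. This
    cancellation lets distinct series roots be divided out. *)
Lemma fps_lreg (K : idomainType) (f : fps K) n : (forall m, (m < n)%N -> f m = 0) ->
  f n != 0 -> forall g : fps K, f * g = 0 -> g = 0.
Proof.
move=> f_low fn g fg0; apply: fpsP => m.
elim/ltn_ind: m => m IH; have [_] := fpsM_low f_low IH.
by rewrite fg0 => /esym/eqP; rewrite mulf_eq0 (negPf fn) /= => /eqP.
Qed.

(** * Convergent series *)

Section Convergence.
Variable R : realType.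
Implicit Types (f g : fps R) (r s B : R).

Lemma geom_bound_le f r s B : 0 <= s <= r ->
  (forall m, `|f m| * r ^+ m <= B) -> forall m, `|f m| * s ^+ m <= B.
Proof.
move=> /andP[s0 sr] fB m; apply: le_trans (fB m).
by rewrite ler_wpM2l ?lerXn2r ?nnegrE // (le_trans s0).
Qed.

Lemma conv1R_common f g : conv1R f -> conv1R g ->
  exists r B, [/\ 0 < r, forall m, `|f m| * r ^+ m <= B
                       & forall m, `|g m| * r ^+ m <= B].
Proof.
move=> [r [B [r0 fB]]] [s [C [s0 gC]]].
exists (Num.min r s), (Num.max B C); split; first by rewrite lt_min r0.
- move=> m; rewrite le_max (geom_bound_le _ fB) //.
  by rewrite le_min (ltW r0) (ltW s0) ge_min lexx.
- move=> m; rewrite le_max (geom_bound_le _ gC) ?orbT //.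
  by rewrite le_min (ltW r0) (ltW s0) ge_min lexx orbT.
Qed.

Lemma conv1R_sub f g : conv1R f -> conv1R g -> conv1R (f - g).
Proof.
move=> cf cg; have [r [B [r0 fB gB]]] := conv1R_common cf cg.
exists r, (B + B); split=> // m; rewrite fpsBE.
apply: le_trans (lerD (fB m) (gB m)).
by rewrite -mulrDl ler_wpM2r ?exprn_ge0 ?(ltW r0) // ler_normB.
Qed.

(* Halving the radius absorbs the [m.+1] terms of the Cauchy product. *)
Lemma conv1R_mul f g : conv1R f -> conv1R g -> conv1R (f * g).
Proof.
move=> cf cg; have [r [B [r0 fB gB]]] := conv1R_common cf cg.
exists (r / 2), (B * B); split=> [|m]; first by lra.
have B0 : 0 <= B by apply: le_trans (fB 0%N); rewrite mulr_ge0 ?exprn_ge0 ?(ltW r0).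
have prodB : `|(f * g) m| * r ^+ m <= (B * B) *+ m.+1.
  rewrite fpsME.
  apply: (@le_trans _ _ (\sum_(i < m.+1) `|f i * g (m - i)%N| * r ^+ m)).
    by rewrite -mulr_suml ler_wpM2r ?exprn_ge0 ?(ltW r0) // ler_norm_sum.
  rewrite -[X in _ <= _ *+ X]card_ord -sumr_const ler_sum // => i _.
  have -> : r ^+ m = r ^+ i * r ^+ (m - i) by rewrite -exprD subnKC // -ltnS.
  rewrite normrM mulrACA; apply: ler_pM => //.
  - by rewrite mulr_ge0 ?exprn_ge0 ?(ltW r0).
  - by rewrite mulr_ge0 ?exprn_ge0 ?(ltW r0).
rewrite expr_div_n mulrA ler_pdivrMr ?exprn_gt0 //.
apply: le_trans prodB _; rewrite -mulr_natr ler_wpM2l ?mulr_ge0 //.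
by rewrite -natrX ler_nat ltn_expl.
Qed.

Lemma conv1R_const (c : R) : conv1R (fps_poly c%:P).
Proof.
exists 1, `|c|; split=> // m /=.
by rewrite expr1n mulr1 coefC; case: eqP => // _; rewrite normr0.
Qed.

(** Made boolean classically, so that it can be declared a subring and combined with [polyOver]. *)
Definition convfps : {pred fps R} := fun f => `[< conv1R f >].

Fact convfps_subring : subring_closed convfps.
Proof.
split=> [|f g /asboolP cf /asboolP cg|f g /asboolP cf /asboolP cg]; apply/asboolP.
- by rewrite -(rmorph1 (@fps_poly R)); exact: conv1R_const.
- exact: conv1R_sub.
- exact: conv1R_mul.
Qed.

HB.instance Definition _ := GRing.isSubringClosed.Build (fps R) convfps convfps_subring.

Lemma convfps_poly (p : {poly R}) : fps_poly p \in convfps.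
Proof.
elim/poly_ind: p => [|p c IH]; first by rewrite rmorph0 rpred0.
rewrite rmorphD rmorphM rpredD ?rpredM //; last exact/asboolP/conv1R_const.
apply/asboolP; exists 1, 1; split=> // m /=.
by rewrite expr1n mulr1 coefX; case: eqP => _; rewrite ?normr0 ?normr1.
Qed.

End Convergence.

Arguments convfps {R}.

(** * Hensel lifting with convergence *)

Section WeightedNorm.
Variable R : realType.
Implicit Types (p w : {poly R}) (r : R).

(** A weighted l1 norm. It is submultiplicative, and a bound uniform along the iterates below
    becomes a geometric bound for their limit. *)
Definition wnorm r p : R := \sum_(i < size p) `|p`_i| * r ^+ i.

Lemma wnormE r p n : (size p <= n)%N -> wnorm r p = \sum_(i < n) `|p`_i| * r ^+ i.
Proof.
move=> pn; rewrite /wnorm -!(big_mkord xpredT (fun i => `|p`_i| * r ^+ i)).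
rewrite [RHS](big_cat_nat (n := size p)) //= [X in _ = _ + X]big_nat [X in _ = _ + X]big1 ?addr0 //.
by move=> i /andP[pi _]; rewrite nth_default // normr0 mul0r.
Qed.

Lemma wnorm0 r : wnorm r 0 = 0.
Proof. by rewrite /wnorm size_poly0 big_ord0. Qed.

Lemma wnormD r p w : 0 <= r -> wnorm r (p + w) <= wnorm r p + wnorm r w.
Proof.
move=> r0; set n := maxn (size p) (size w).
rewrite (@wnormE _ _ n) ?size_polyD // (@wnormE _ p n) ?leq_maxl //.
rewrite (@wnormE _ w n) ?leq_maxr // -big_split /= ler_sum // => i _.
by rewrite -mulrDl coefD ler_wpM2r ?exprn_ge0 // ler_normD.
Qed.

Lemma wnormMXaddC r p c : wnorm r (p * 'X + c%:P) = r * wnorm r p + `|c|.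
Proof.
rewrite (@wnormE _ _ (size p).+1); last first.
  by rewrite size_MXaddC; case: ifP.
rewrite big_ord_recl /= coefD coefMX coefC /= add0r expr0 mulr1 addrC.
congr (_ + _); rewrite /wnorm mulr_sumr; apply: eq_bigr => i _.
by rewrite coefD coefMX coefC /= addr0 exprS; ring.
Qed.

Lemma wnormMX r p : wnorm r (p * 'X) = r * wnorm r p.
Proof. by have := wnormMXaddC r p 0; rewrite addr0 normr0 addr0. Qed.

Lemma wnormZ r c p : wnorm r (c *: p) = `|c| * wnorm r p.
Proof.
rewrite (@wnormE _ _ (size p)) ?size_scale_leq // /wnorm mulr_sumr.
by apply: eq_bigr => i _; rewrite coefZ normrM mulrA.
Qed.

Lemma wnorm_ge0 r p : 0 <= r -> 0 <= wnorm r p.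
Proof. by move=> r0; apply: sumr_ge0 => i _; rewrite mulr_ge0 ?exprn_ge0. Qed.

Lemma wnormM r p w : 0 <= r -> wnorm r (p * w) <= wnorm r p * wnorm r w.
Proof.
move=> r0; elim/poly_ind: p => [|p c IH]; first by rewrite mul0r wnorm0 mul0r.
rewrite wnormMXaddC mulrDl mulrAC; apply: le_trans (wnormD _ _ r0) _.
rewrite wnormMX mul_polyC wnormZ mulrDl lerD2r -mulrA.
by rewrite ler_wpM2l.
Qed.

Lemma wnorm_coef r p i : 0 <= r -> `|p`_i| * r ^+ i <= wnorm r p.
Proof.
move=> r0; have [pi|ip] := leqP (size p) i.
  by rewrite nth_default // normr0 mul0r wnorm_ge0.
rewrite /wnorm (bigD1 (Ordinal ip)) //= lerDl sumr_ge0 // => j _.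
by rewrite mulr_ge0 ?exprn_ge0.
Qed.

Lemma wnorm_mono r p : 0 <= r <= 1 -> wnorm r p <= wnorm 1 p.
Proof.
move=> /andP[r0 r1]; apply: ler_sum => i _.
by rewrite ler_wpM2l // lerXn2r ?nnegrE.
Qed.

(** The bound must not depend on [r], since the radius is later chosen in terms of it; monotonicity
    of [wnorm] in [r] makes this possible. *)
Lemma wnorm_horner_bounded (Psi : {poly {poly R}}) : exists2 B : R, 0 <= B &
  forall r w, 0 <= r <= 1 -> wnorm r w <= 1 -> wnorm r Psi.[w] <= B.
Proof.
elim/poly_ind: Psi => [|Psi c [B B0 hB]].
  by exists 0 => // r w _ _; rewrite horner0 wnorm0.
exists (B + wnorm 1 c); first by rewrite addr_ge0 // wnorm_ge0.
move=> r w r01 w1; have /andP[r0 r1] := r01.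
rewrite hornerMXaddC; apply: le_trans (wnormD _ _ r0) _.
rewrite lerD ?wnorm_mono //; apply: le_trans (wnormM _ _ r0) _.
rewrite -[B]mulr1; apply: ler_pM; rewrite ?wnorm_ge0 //; exact: hB.
Qed.

End WeightedNorm.

Lemma horner_diff (A : comNzRingType) (p : {poly A}) (a b : A) :
  exists e, p.[a] - p.[b] = (a - b) * e.
Proof.
elim/poly_ind: p => [|p c [e pe]]; first by exists 0; rewrite !horner0; ring.
exists (p.[a] + b * e); rewrite !hornerMXaddC.
by rewrite mulrDr mulrCA -pe; ring.
Qed.

Section FixedPoint.
Variable R : realType.
Variable Phi : {poly {poly R}}.
Hypotheses (Phi0 : Phi`_0`_0 = 0) (Phi1 : Phi`_1`_0 = 0).

Lemma poly_factorX (p : {poly R}) : p`_0 = 0 -> exists a, p = a * 'X.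
Proof.
elim/poly_ind: p => [|p c _]; first by exists 0; rewrite mul0r.
by rewrite coefD coefMX coefC /= add0r => ->; exists p; rewrite addr0.
Qed.

(** [Phi0] and [Phi1] remove the monomials 1 and w, so what remains is divisible by x or by w^2, and
    [Phi] contracts near the origin. *)
Lemma Phi_split : exists a b Psi, forall w : {poly R},
  Phi.[w] = a * 'X + b * 'X * w + w ^+ 2 * Psi.[w].
Proof.
have [a aE] := poly_factorX Phi0; have [b bE] := poly_factorX Phi1.
exists a, b, (drop_poly 2 Phi) => w.
rewrite -{1}(poly_take_drop 2 Phi) hornerD hornerM hornerXn [_.[w] * _]mulrC.
congr (_ + _); rewrite -aE -bE horner_poly !big_ord_recl big_ord0 /=.
by rewrite expr0 expr1 mulr1 addr0.
Qed.

Definition fixed_iter n : {poly R} := iter n (fun w => Phi.[w]) 0.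

Lemma fixed_iterS n : fixed_iter n.+1 = Phi.[fixed_iter n].
Proof. by []. Qed.

Lemma fixed_iter_coef0 n : exists c, fixed_iter n = c * 'X.
Proof.
have [a [b [Psi PhiE]]] := Phi_split.
elim: n => [|n [c IH]]; first by exists 0; rewrite mul0r.
rewrite fixed_iterS PhiE {}IH.
by exists (a + b * (c * 'X) + c * (c * 'X) * Psi.[c * 'X]); ring.
Qed.

(** The iteration contracts x-adically: all iterates are divisible by ['X], so each application of
    [Phi] multiplies the difference of consecutive iterates by a multiple of ['X]. *)
Lemma fixed_iter_step n : exists e, fixed_iter n.+1 - fixed_iter n = 'X^(n.+1) * e.
Proof.
have [a [b [Psi PhiE]]] := Phi_split.
elim: n => [|n [e IH]].
  exists a; rewrite fixed_iterS PhiE; ring.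
rewrite [fixed_iter n.+2]fixed_iterS [X in _ - X]fixed_iterS.
have [c cE] := fixed_iter_coef0 n; have [c' cE'] := fixed_iter_coef0 n.+1.
have [d dE] := horner_diff Psi (fixed_iter n.+1) (fixed_iter n).
set v := fixed_iter n in IH cE dE *; set v' := fixed_iter n.+1 in IH cE' dE *.
rewrite !PhiE.
have -> : a * 'X + b * 'X * v' + v' ^+ 2 * Psi.[v']
   - (a * 'X + b * 'X * v + v ^+ 2 * Psi.[v])
   = (v' - v) * (b * 'X + (v' + v) * Psi.[v']) + v ^+ 2 * (Psi.[v'] - Psi.[v]).
  ring.
rewrite dE IH.
exists (e * (b + (c' + c) * Psi.[v'] + c * v * d)).
have -> : v' + v = (c' + c) * 'X by rewrite cE cE'; ring.
have -> : v ^+ 2 = c * v * 'X by rewrite expr2 {1}cE; ring.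
by rewrite [in RHS]exprS; ring.
Qed.

Lemma fixed_iter_stable m n : (m < n)%N -> (fixed_iter n)`_m = (fixed_iter m.+1)`_m.
Proof.
move=> /subnKC <-; elim: (n - m.+1)%N => [|d IH]; first by rewrite addn0.
rewrite addnS -IH; apply/eqP; rewrite -subr_eq0 -coefB.
by have [e ->] := fixed_iter_step (m.+1 + d); rewrite coefXnM; case: ltnP => //; lia.
Qed.

Lemma fixed_iter_bounded : exists r B : R, 0 < r /\ forall n, wnorm r (fixed_iter n) <= B.
Proof.
have [a [b [Psi PhiE]]] := Phi_split.
have [C C0 hC] := wnorm_horner_bounded Psi.
pose D := C + wnorm 1 a + wnorm 1 b + 1.
have a0 := @wnorm_ge0 _ 1 a ler01; have b0 := @wnorm_ge0 _ 1 b ler01.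
(* The constants satisfy [rho * D = 1 / 2] and [r * D = rho / 4]. On an iterate of norm at most
   [rho], the three terms of [Phi_split] are then at most [rho / 4], [rho / 4] and
   [rho * rho * D = rho / 2], so the ball of radius [rho] is preserved. *)
have D1 : 1 <= D by rewrite /D; lra.
pose rho := (2 * D)^-1; pose r := rho / (4 * D).
have D0 : 0 < D by lra.
have rho0 : 0 < rho by rewrite invr_gt0; lra.
have rhoD : rho * D = 1 / 2 by rewrite /rho; field; lra.
have rho1 : rho <= 1 by nra.
have r0 : 0 < r by rewrite divr_gt0 //; lra.
have rD : r * D = rho / 4 by rewrite /r; field; lra.
have r1 : r <= 1 by nra.
have r01 : 0 <= r <= 1 by rewrite ltW.
have ar : wnorm r a <= D by apply: le_trans (wnorm_mono _ r01) _; rewrite /D; lra.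
have br : wnorm r b <= D by apply: le_trans (wnorm_mono _ r01) _; rewrite /D; lra.
exists r, rho; split=> //; elim=> [|n IH]; first by rewrite /= wnorm0 ltW.
rewrite fixed_iterS PhiE.
have v0 := @wnorm_ge0 _ r (fixed_iter n) (ltW r0).
have vC := hC r (fixed_iter n) r01 (le_trans IH rho1).
set v := fixed_iter n in IH v0 vC *.
apply: le_trans (wnormD _ _ (ltW r0)) _.
have h1 : wnorm r (a * 'X) <= rho / 4.
  by rewrite wnormMX -rD ler_pM2l.
have h2 : wnorm r (b * 'X * v) <= rho / 4.
  apply: le_trans (wnormM _ _ (ltW r0)) _; rewrite wnormMX -rD.
  have := @wnorm_ge0 _ r b (ltW r0) => br0.
  rewrite -mulrA ler_pM2l // -[D]mulr1; apply: ler_pM => //.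
  exact: le_trans IH rho1.
have h3 : wnorm r (v ^+ 2 * Psi.[v]) <= rho / 2.
  apply: le_trans (wnormM _ _ (ltW r0)) _.
  have -> : rho / 2 = rho * rho * D by rewrite -mulrA rhoD; ring.
  apply: ler_pM; rewrite ?wnorm_ge0 ?(ltW r0) //.
    by rewrite expr2; apply: le_trans (wnormM _ _ (ltW r0)) _; apply: ler_pM.
  by apply: le_trans vC _; rewrite /D; lra.
have h4 := wnormD (a * 'X) (b * 'X * v) (ltW r0).
lra.
Qed.

Lemma fixed_point : exists2 w : fps R, w \in convfps &
  w 0%N = 0 /\ (map_poly (@fps_poly R) Phi).[w] = w.
Proof.
pose w := Fps (fun m => (fixed_iter m.+1)`_m).
have [r [B [r0 hB]]] := fixed_iter_bounded.
exists w; first by apply/asboolP; exists r, B; split=> // m /=;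
  apply: le_trans (hB m.+1); apply: wnorm_coef; exact: ltW.
split; first by have [c /= ->] := fixed_iter_coef0 1; rewrite coefMX.
apply: fpsP => m.
(* The limit and this iterate agree up to index [m], hence so do their images under [Phi]. *)
have [e] := horner_diff (map_poly (@fps_poly R) Phi) w (fps_poly (fixed_iter m.+1)).
move/(congr1 (fun f : fps R => f m)); rewrite fpsBE.
have low : forall i, (i < m.+1)%N -> (w - fps_poly (fixed_iter m.+1)) i = 0.
  by move=> i im; rewrite fpsBE /= (fixed_iter_stable im) subrr.
have e_low : forall i, (i < 0)%N -> e i = 0 by [].
rewrite (fpsM_low low e_low).1 ?addn0 //; move/eqP; rewrite subr_eq0 => /eqP ->.
by rewrite horner_map -fixed_iterS; exact: fixed_iter_stable.
Qed.

End FixedPoint.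

(** With [z] moved to the origin, so that F(x,w) = Q(x,w+z), the fixed points of w - F/d are the
    roots of F. The choice of d as the derivative of [r] at [z] cancels the linear term in w at x =
    0. *)
Lemma hensel (R : realType) (Q : {poly {poly R}}) (z : R) (r : {poly R}) :
  (forall n, r`_n = Q`_n`_0) -> r.[z] = 0 -> r^`().[z] != 0 ->
  exists2 w : fps R, w \in convfps & w 0%N = z /\ (map_poly (@fps_poly R) Q).[w] = 0.
Proof.
move=> rE rz0 dz; set d := r^`().[z] in dz.
pose F := Q \Po ('X + z%:P%:P).
have rmap : map_poly (horner_eval 0) Q = r.
  by apply/polyP => n; rewrite coef_map /= /horner_eval horner_coef0 rE.
have Fmap : map_poly (horner_eval 0) F = r \Po ('X + z%:P).
  by rewrite map_comp_poly rmap rmorphD /= map_polyX map_polyC /= /horner_eval hornerC.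
have F0 n : F`_n`_0 = (r \Po ('X + z%:P))`_n.
  by rewrite -Fmap coef_map /= /horner_eval horner_coef0.
pose Phi := 'X - (d^-1)%:P%:P * F.
have Phi0 : Phi`_0`_0 = 0.
  rewrite /Phi coefB coefX coefCM coefB coefCM coef0 F0.
  by rewrite -horner_coef0 horner_comp !hornerE ?add0r rz0 mulr0 oppr0.
have Phi1 : Phi`_1`_0 = 0.
  rewrite /Phi coefB coefX coefCM coefB coefCM coef1 F0.
  have -> : (r \Po ('X + z%:P))`_1 = d.
    have := coef_deriv (r \Po ('X + z%:P)) 0; rewrite mulr1n => <-.
    rewrite deriv_comp derivD derivX derivC addr0 mulr1 -horner_coef0.
    by rewrite horner_comp !hornerE ?add0r.
  by rewrite mulVf // subrr.
have [w wconv [w0 wfix]] := fixed_point Phi0 Phi1.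
exists (w + fps_poly z%:P).
  by rewrite rpredD ?convfps_poly.
split; first by rewrite fpsDE w0 add0r /= coefC.
have FQ : (map_poly (@fps_poly R) F).[w] = (map_poly (@fps_poly R) Q).[w + fps_poly z%:P].
  by rewrite map_comp_poly horner_comp rmorphD /= map_polyX map_polyC !hornerE.
rewrite -FQ; move: wfix; rewrite /Phi rmorphB rmorphM /= map_polyX map_polyC hornerD hornerN.
rewrite hornerM hornerX hornerC => /eqP; rewrite -subr_eq0 addrAC subrr add0r oppr_eq0.
move/eqP/(congr1 ( *%R (fps_poly d%:P))); rewrite mulrA -rmorphM /= -polyCM mulfV //.
by rewrite rmorph1 mul1r mulr0.
Qed.

(** * Splitting off roots *)

Lemma polyOver_divXsubC (A : comNzRingType) (S : subringClosed A) (p : {poly A}) y :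
  p \is a polyOver S -> y \in S ->
  exists2 s, s \is a polyOver S & p = s * ('X - y%:P) + p.[y]%:P.
Proof.
move=> pS yS; elim/poly_ind: p pS => [_|p c IH pS].
  by exists 0; rewrite ?rpred0 // mul0r horner0 addr0.
have pS' : p \is a polyOver S.
  apply/polyOverP => i; have /polyOverP/(_ i.+1) := pS.
  by rewrite coefD coefMX coefC /= addr0.
have [s sS pE] := IH pS'.
exists (s * 'X + p.[y]%:P).
  by rewrite rpredD ?rpredM ?polyOverX ?polyOverC // rpred_horner.
by rewrite hornerMXaddC {1}pE rmorphD rmorphM /=; ring.
Qed.

(** Induction on the list of roots: at a new root the linear factors already split off take regular
    values, so the cofactor vanishes there. Division by a monic linear factor stays inside [S]; for
    [convfps] this keeps the cofactor convergent. *)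
Lemma polyOver_factor_roots (A : comNzRingType) (S : subringClosed A)
    (I : finType) (p : {poly A}) (y : I -> A) :
  p \is a polyOver S -> (forall i, y i \in S) -> (forall i, p.[y i] = 0) ->
  (forall i j, i != j -> forall g, (y i - y j) * g = 0 -> g = 0) ->
  exists2 s, s \is a polyOver S & p = s * \prod_i ('X - (y i)%:P).
Proof.
move=> pS yS py yreg; rewrite -big_enum /=.
elim: (enum I) (enum_uniq I) => [_|i l IH /= /andP[il /IH[s sS pE]]].
  by exists p; rewrite ?big_nil ?mulr1.
have si : s.[y i] = 0.
  have := py i; rewrite pE hornerM; elim: l il {IH pE} => [_|j l IH].
    by rewrite big_nil hornerE mulr1.
  rewrite inE negb_or => /andP[ij /IH{}IH]; rewrite big_cons hornerM mulrCA.
  by rewrite hornerXsubC => /(yreg _ _ ij).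
have [s' s'S sE] := polyOver_divXsubC sS (yS i).
exists s' => //; rewrite big_cons {1}pE {1}sE si addr0; ring.
Qed.

(** * Passage to coefficient families in two variables *)

Section ToSer2.
Variables (R : realType) (K : comNzRingType) (f : {rmorphism K -> R[i]}).

(** Polynomials in y have series in x as coefficients, whence the swapped indices. The morphism [f]
    is the identity for the given complex factorization and [real_complex R] for the real one to be
    found. *)
Definition toS2 (S : {poly (fps K)}) : ser2 R := fun m n => f (S`_n m).

Lemma toS2M S T : toS2 (S * T) = mulS (toS2 S) (toS2 T).
Proof.
apply/funext => m; apply/funext => n; rewrite /toS2 /mulS coefM fps_sumE rmorph_sum.
rewrite exchange_big; apply: eq_bigr => j _; rewrite fpsME rmorph_sum.
by apply: eq_bigr => i _; rewrite rmorphM.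
Qed.

Lemma toS2_1 : toS2 1 = oneS R.
Proof.
apply/funext => m; apply/funext => n; rewrite /toS2 /oneS coef1.
by case: (n == 0%N); rewrite ?andbT ?andbF /= ?rmorph0 // rmorph_nat.
Qed.

Lemma toS2_lin (h : fps K) : toS2 ('X + h%:P) = lin1 (fun m => f (h m)).
Proof.
apply/funext => m; apply/funext => -[|[|n]]; rewrite /toS2 /lin1 coefD coefX coefC /=.
- by rewrite add0r.
- by rewrite addr0 rmorph_nat.
- by rewrite addr0 rmorph0.
Qed.

Lemma toS2_prod (I : finType) (h : I -> fps K) :
  toS2 (\prod_i ('X + (h i)%:P)) =
  \big[@mulS R/oneS R]_i lin1 (fun m => f (h i m)).
Proof.
rewrite (big_morph toS2 toS2M toS2_1); apply: eq_bigr => i _; exact: toS2_lin.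
Qed.

End ToSer2.

Lemma conv2_toS2 (R : realType) (S : {poly (fps R)}) : S \is a polyOver convfps ->
  conv2 (toS2 (real_complex R) S).
Proof.
move=> cS.
(* A polynomial in y has finitely many coefficient series, hence a common radius; keeping it at most
   1 lets the power [r ^+ n] be dropped. *)
have bound N : exists r B : R, [/\ 0 < r, r <= 1 & forall n m, (n < N)%N ->
    `|S`_n m| * r ^+ m <= B].
  elim: N => [|N [r [B [r0 r1 hB]]]]; first by exists 1, 1; split.
  have /asboolP[s [C [s0 hC]]] := polyOverP cS N.
  exists (Num.min r s), (Num.max B C); split.
  - by rewrite lt_min r0.
  - by rewrite ge_min r1.
  - move=> n m; rewrite ltnS leq_eqVlt le_max => /orP[/eqP ->|nN].
      apply/orP; right; apply: (geom_bound_le _ hC).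
      by rewrite le_min (ltW r0) (ltW s0) ge_min lexx orbT.
    apply/orP; left; apply: (geom_bound_le _ (fun m => hB n m nN)).
    by rewrite le_min (ltW r0) (ltW s0) ge_min lexx.
have [r [B [r0 r1 hB]]] := bound (size S).
exists r, (Num.max B 0); split=> // m n; rewrite /toS2 -rmorphXn /=.
have -> : `|((S`_n m)%:C)%C| = (`|S`_n m|%:C)%C.
  by rewrite normc_def /= expr0n /= addr0 sqrtr_sqr.
rewrite -rmorphM lecR /= le_max; case: (ltnP n (size S)) => nS; last first.
  by rewrite nth_default //= normr0 mul0r lexx orbT.
apply/orP; left; apply: le_trans (hB n m nS); rewrite ler_wpM2l // exprD.
rewrite ler_piMr ?exprn_ge0 ?(ltW r0) //.
by rewrite exprn_ile1 ?(ltW r0).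
Qed.

(** * The pencil of real parts and the Hermite-Biehler theorem *)

Section Pencil.
Variables (R : realType) (t : R).
Local Notation C := R[i].
Local Notation toC := (real_complex R).
Implicit Types (v w : C) (z : R).

(** Applied to the coefficients of P, it yields those of A + t B. It is linear over the reals only,
    so products are handled with one factor real. *)
Definition pencil w : R := complex.Re w + t * complex.Im w.

Arguments pencil : simpl never.

Fact pencil_is_zmod_morphism : zmod_morphism pencil.
Proof. by move=> [a b] [c d]; rewrite /pencil /=; ring. Qed.
HB.instance Definition _ :=
  GRing.isZmodMorphism.Build C R pencil pencil_is_zmod_morphism.

Lemma pencilMr w z : pencil (w * (z%:C)%C) = pencil w * z.
Proof. by case: w => a b; rewrite /pencil /=; ring. Qed.

Lemma pencilE w : ((pencil w)%:C)%C =
  2^-1 * (w + (w^*)%C) + (t%:C)%C * ((2 * 'i%C)^-1 * (w - (w^*)%C)).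
Proof.
have i0 : 'i%C != 0 :> C by rewrite eq_complex /= negb_and oner_eq0 orbT.
have -> : (2 * 'i%C)^-1 * (w - (w^*)%C) = ((complex.Im w)%:C)%C.
  by rewrite subcJ; field; rewrite i0.
have -> : 2^-1 * (w + (w^*)%C) = ((complex.Re w)%:C)%C by rewrite addcJ; field.
by rewrite /pencil rmorphD rmorphM.
Qed.

Lemma map_pencilM (p : {poly C}) (r : {poly R}) :
  map_poly pencil (p * map_poly toC r) = map_poly pencil p * r.
Proof.
apply/polyP => n; rewrite coef_map !coefM raddf_sum.
by apply: eq_bigr => i _; rewrite !coef_map /= pencilMr.
Qed.

Lemma horner_map_pencil (p : {poly C}) z :
  (map_poly pencil p).[z] = pencil p.[(z%:C)%C].
Proof.
elim/poly_ind: p => [|p c IH]; first by rewrite raddf0 !horner0 raddf0.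
rewrite raddfD /= map_polyC /= -['X](map_polyX toC) map_pencilM /= !hornerE IH.
by rewrite map_polyX !hornerE raddfD /= pencilMr /pencil addrA.
Qed.

Lemma horner_map2_pencil (P : {poly {poly C}}) (h : {poly R}) :
  (map_poly (map_poly pencil) P).[h] = map_poly pencil P.[map_poly toC h].
Proof.
elim/poly_ind: P => [|P c IH]; first by rewrite raddf0 !horner0 raddf0.
have -> : map_poly (map_poly pencil) (P * 'X + c%:P) =
    map_poly (map_poly pencil) P * 'X + (map_poly pencil c)%:P.
  apply/polyP => n; rewrite coef_map /= !coefD !coefMX !coefC.
  by case: n => [|n] /=; rewrite ?add0r ?addr0 ?coef_map.
by rewrite !hornerMXaddC IH -map_pencilM raddfD.
Qed.

Lemma deriv_map_pencil (p : {poly C}) :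
  (map_poly pencil p)^`() = map_poly pencil p^`().
Proof. by apply/polyP => n; rewrite coef_deriv !coef_map coef_deriv /= raddfMn. Qed.

Lemma pencil_eq0P w : pencil w = 0 -> complex.Re w = - (t * complex.Im w).
Proof. by move/eqP; rewrite /pencil addr_eq0 => /eqP. Qed.


Section HermiteBiehler.
Variables (s : seq C) (c : C).
Hypothesis s_upper : all (fun a => 0 < complex.Im a) s.

(** The sign convention matches the factors psi_j(0) - z in which it arises. *)
Definition hbpoly (l : seq C) : {poly C} := \prod_(a <- l) (a%:P - 'X).

Lemma hbpoly_real_neq0 z : (hbpoly s).[(z%:C)%C] != 0.
Proof.
rewrite horner_prod prodf_seq_neq0; apply/allP => -[a b] /(allP s_upper) /= b0.
by rewrite !hornerE eq_complex negb_and /= oppr0 addr0 (gt_eqF b0) orbT.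
Qed.

(* [Im (H' / H)] is positive on the real line, a root [a] of [H] contributing
   [Im a / |a - z|^2]. *)
Lemma hbpoly_wronskian z (v := (hbpoly s).[(z%:C)%C])
    (v' := (hbpoly s)^`().[(z%:C)%C]) : s != [::] ->
  0 < complex.Im v' * complex.Re v - complex.Re v' * complex.Im v.
Proof.
suff: 0 <= complex.Im v' * complex.Re v - complex.Re v' * complex.Im v /\ (s != [::] ->
    0 < complex.Im v' * complex.Re v - complex.Re v' * complex.Im v) by case.
rewrite {}/v {}/v' /hbpoly; elim: s s_upper => [_|a l IH /= /andP[a0 la]].
  by rewrite big_nil derivC !hornerE /= oppr0.
have {IH} [W _] := IH la; rewrite big_cons derivM derivB derivC derivX sub0r.
rewrite !hornerE; set h := (\prod_(b <- l) _) in W *.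
have h0 : h.[(z%:C)%C] != 0.
  rewrite horner_prod prodf_seq_neq0; apply/allP => -[x b] /(allP la) /= b0.
  by rewrite !hornerE eq_complex negb_and /= oppr0 addr0 (gt_eqF b0) orbT.
case: (h.[_]) h0 W => p r; case: (h^`().[_]) => p' r'; case: a a0 => a b /= b0 h0 W.
have h2 : 0 < p ^+ 2 + r ^+ 2.
  rewrite lt_neqAle addr_ge0 ?sqr_ge0 // andbT eq_sym paddr_eq0 ?sqr_ge0 //.
  by move: h0; rewrite eq_complex /= !sqrf_eq0.
have X0 : 0 < b * (p ^+ 2 + r ^+ 2) + ((a - z) ^+ 2 + b ^+ 2) * (r' * p - p' * r).
  by rewrite ltr_wpDr ?mulr_gt0 // mulr_ge0 // addr_ge0 ?sqr_ge0.
suff X1 : 0 < (-1 * r + - 0 * p + ((a - z) * r' + (b - 0) * p')) *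
    ((a - z) * p - (b - 0) * r) -
    (-1 * p - - 0 * r + ((a - z) * p' - (b - 0) * r')) *
    ((a - z) * r + (b - 0) * p) by split=> [|_]; [exact: ltW X1|exact: X1].
by move: X0; congr (_ < _); ring.
Qed.

Hypothesis c_lead : pencil c != 0.

Let hp : {poly R} := map_poly pencil (c *: hbpoly s).

Lemma size_hbpoly (l : seq C) : size (hbpoly l) = (size l).+1.
Proof.
rewrite /hbpoly; elim: l => [|a l IH]; first by rewrite big_nil size_poly1.
rewrite big_cons -opprB mulNr size_polyN size_mul ?polyXsubC_eq0 //; last first.
  by rewrite -size_poly_eq0 IH.
by rewrite IH size_XsubC.
Qed.

Lemma lead_coef_hbpoly (l : seq C) : lead_coef (hbpoly l) = (-1) ^+ size l.
Proof.
rewrite /hbpoly lead_coef_prod; elim: l => [|a l IH]; rewrite ?big_nil // big_cons IH.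
by rewrite /= exprS -opprB lead_coefN lead_coefXsubC.
Qed.

(** Up to sign the top coefficient is [pencil c], so [c_lead] excludes a drop in degree. *)
Lemma size_hp : size hp = (size s).+1.
Proof.
apply/eqP; rewrite eqn_leq; apply/andP; split.
  rewrite (leq_trans (size_poly _ _)) // (leq_trans (size_scale_leq _ _)) //.
  by rewrite size_hbpoly.
rewrite ltnNge; apply/negP => /leq_sizeP/(_ _ (leqnn _))/eqP; apply/negP.
rewrite coef_map coefZ /=.
have -> : (hbpoly s)`_(size s) = ((-1) ^+ size s)%:C%C.
  by have := lead_coef_hbpoly s; rewrite lead_coefE size_hbpoly /= => ->; rewrite rmorphXn rmorphN1.
by rewrite pencilMr mulf_neq0 // expf_neq0 // oppr_eq0 oner_eq0.
Qed.

(** At a double root the values of c H and c H' both lie on the line Re = - t Im, so the expression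
    of [hbpoly_wronskian], multiplied by |c|^2, would vanish. *)
Lemma hp_deriv_neq0 z : hp.[z] = 0 -> hp^`().[z] != 0.
Proof.
have [s0|sn0] := eqVneq s [::].
  have := size_hp; rewrite s0 /= => /eqP /size_poly1P[k k0 ->].
  by rewrite hornerC => k00; rewrite k00 eqxx in k0.
have W := hbpoly_wronskian z sn0.
rewrite /hp deriv_map_pencil !horner_map_pencil derivZ !hornerZ => /pencil_eq0P v0.
apply/eqP => /pencil_eq0P v'0.
have c0 : c != 0 by apply: contraNneq c_lead => ->; rewrite raddf0.
move: c0 v0 v'0 W; case: (_.[_]) => p r; case: (_.[_]) => p' r'.
case: c => a b; rewrite eq_complex /= negb_and => c0 v0 v'0 W.
have c2 : 0 < a ^+ 2 + b ^+ 2.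
  rewrite lt_neqAle addr_ge0 ?sqr_ge0 // andbT eq_sym paddr_eq0 ?sqr_ge0 //.
  by rewrite !sqrf_eq0 negb_and.
suff : (a ^+ 2 + b ^+ 2) * (r' * p - p' * r) = 0.
  by move/eqP; rewrite mulf_eq0 !gt_eqF.
have -> : (a ^+ 2 + b ^+ 2) * (r' * p - p' * r) =
  (a * r' + b * p') * (a * p - b * r) - (a * p' - b * r') * (a * r + b * p) by ring.
rewrite v0 v'0; ring.
Qed.

(* A point of the upper half plane is closer to [a] than to its conjugate, so
   off the real line the two halves of the pencil have different moduli. *)
Lemma hbpoly_norm_lt (z : C) (l : seq C) : 0 < complex.Im z ->
  all (fun a => 0 < complex.Im a) l -> l != [::] ->
  `|(hbpoly l).[z]| < `|(map_poly conjc (hbpoly l)).[z]|.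
Proof.
move=> z0 lu ln0; rewrite /hbpoly rmorph_prod !horner_prod !normr_prod /=.
suff : \prod_(a <- l) `|(a%:P - 'X).[z]| <=
    \prod_(a <- l) `|(map_poly conjc (a%:P - 'X)).[z]| /\
    (l != [::] -> \prod_(a <- l) `|(a%:P - 'X).[z]| <
    \prod_(a <- l) `|(map_poly conjc (a%:P - 'X)).[z]|) by case=> _; apply.
elim: l lu {ln0} => [_|a l IH lu]; first by rewrite !big_nil.
have /= /andP[a0 /IH[{}IH _]] := lu.
rewrite !big_cons.
have az : `|(a%:P - 'X).[z]| < `|(map_poly conjc (a%:P - 'X)).[z]|.
  rewrite rmorphB /= map_polyC map_polyX !hornerE !normc_def ltcR.
  case: a z a0 z0 {IH lu} => a b [x y] /= b0 y0.
  have by0 : 0 < b * y by rewrite mulr_gt0.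
  rewrite ltr_sqrt; first by rewrite ltrD2l !expr2; lra.
  rewrite ltr_wpDl ?sqr_ge0 // exprn_even_gt0 //=; lra.
have lt : `|(a%:P - 'X).[z]| * \prod_(b <- l) `|(b%:P - 'X).[z]| <
    `|(map_poly conjc (a%:P - 'X)).[z]| *
      \prod_(b <- l) `|(map_poly conjc (b%:P - 'X)).[z]|.
  apply: (@le_lt_trans _ _ (`|(a%:P - 'X).[z]| *
      \prod_(b <- l) `|(map_poly conjc (b%:P - 'X)).[z]|)).
    by rewrite ler_wpM2l.
  rewrite ltr_pM2r //; rewrite big_seq; apply: prodr_gt0 => b bl.
  rewrite normr_gt0 rmorphB /= map_polyC map_polyX !hornerE eq_complex negb_and.
  have := allP lu b; rewrite inE bl orbT => /(_ isT).
  case: b z z0 {bl IH az} => b b' [x y] /= y0 b0; apply/orP; right.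
  by rewrite lt_eqF //; lra.
by split=> [|_]; [exact: ltW lt|exact: lt].
Qed.

Lemma map_pencilE (p : {poly C}) (k := (2^-1 -i* (t / 2))%C) :
  map_poly toC (map_poly pencil p) = k *: p + (k^*)%C *: map_poly conjc p.
Proof.
apply/polyP => n; rewrite coefD !coefZ !coef_map /= /pencil /k.
by case: (p`_n) => a b; apply/eqP; rewrite eq_complex /=; apply/andP; split;
  apply/eqP; field.
Qed.

(** At a root, [map_pencilE] forces H and its coefficientwise conjugate to have equal moduli, which
    [hbpoly_norm_lt] excludes in the upper half plane. The lower half plane follows by conjugation,
    [hp] being real. *)
Lemma hp_root_real (z : C) : (map_poly toC hp).[z] = 0 -> complex.Im z = 0.
Proof.
have c0 : c != 0 by apply: contraNneq c_lead => ->; rewrite raddf0.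
have [s0|sn0] := eqVneq s [::].
  have := size_hp; rewrite s0 /= => /eqP /size_poly1P[k k0 ->].
  by rewrite map_polyC hornerC => -[] /eqP; rewrite (negPf k0).
have upper (x : C) : (map_poly toC hp).[x] = 0 -> ~ 0 < complex.Im x.
  move=> hx x0; have := hbpoly_norm_lt x0 s_upper sn0.
  move: hx; rewrite /hp map_pencilE; set k := (_ -i* _)%C.
  have k0 : k != 0 by rewrite eq_complex /= negb_and invr_eq0 pnatr_eq0.
  have -> : map_poly conjc (c *: hbpoly s) = (c^*)%C *: map_poly conjc (hbpoly s).
    by rewrite -mul_polyC rmorphM /= map_polyC mul_polyC.
  rewrite !hornerE => /eqP; rewrite addr_eq0 => /eqP /(congr1 Num.norm).
  rewrite normrN !normrM !normcJ => /mulfI /= h.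
  by rewrite h ?ltxx // mulf_neq0 ?normr_eq0.
move=> hz; have hz' : (map_poly toC hp).[(z^*)%C] = 0.
  apply: (can_inj (@conjcK R)); rewrite -horner_map rmorph0 /= conjcK.
  by rewrite -map_poly_comp (eq_map_poly (@conjc_real R)).
have [lt|gt|//] := ltrgtP (complex.Im z) 0; last by case: (upper _ hz).
by case: z hz' {hz} lt => a b hz' /= b0; case: (upper _ hz'); rewrite oppr_gt0.
Qed.

Lemma hermite_biehler : exists l : seq R, [/\ uniq l, size l = size s &
  forall z, z \in l -> hp.[z] = 0 /\ hp^`().[z] != 0].
Proof.
have [l lE] := closed_field_poly_normal (map_poly toC hp).
have hp0 : hp != 0 by rewrite -size_poly_eq0 size_hp.
have lc0 : lead_coef (map_poly toC hp) != 0.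
  by rewrite lead_coef_eq0 map_poly_eq0.
have rootl (z : C) : z \in l -> root (map_poly toC hp) z.
  by move=> zl; rewrite lE rootZ // root_prod_XsubC.
have lreal (z : C) : z \in l -> z = ((complex.Re z)%:C)%C.
  move=> /rootl /rootP /hp_root_real; case: z => a b /= ->; by [].
have rootR (z : C) : z \in l -> hp.[complex.Re z] = 0.
  move=> zl; apply: (@complexI R); rewrite -horner_map /=.
  by rewrite -(lreal _ zl) rmorph0; exact/rootP/rootl.
exists (map (@complex.Re R) l); split.
- rewrite map_inj_in_uniq; last first.
    by move=> x y xl yl xy; rewrite (lreal _ xl) (lreal _ yl) xy.
  have hpl : map_poly toC hp %= \prod_(z <- l) ('X - z%:P) by rewrite lE eqp_scale.
  rewrite -separable_prod_XsubC -(eqp_separable hpl) unlock.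
  apply: Pdiv.ClosedField.root_coprimep => z zr; have zl : z \in l.
    by move: zr; rewrite lE rootZ // root_prod_XsubC.
  rewrite deriv_map (lreal _ zl) horner_map fmorph_eq0.
  exact/hp_deriv_neq0/rootR.
- have := size_hp; rewrite size_map -(size_map_poly toC) lE size_scale //.
  by rewrite size_prod_XsubC => -[].
- by move=> _ /mapP[z zl ->]; have := rootR _ zl; split=> //; exact: hp_deriv_neq0.
Qed.

End HermiteBiehler.
End Pencil.

(** * Substitution into the given factorization *)

Lemma fps_exp_low (K : comNzRingType) (h : fps K) n : h 0%N = 0 ->
  forall m, (m < n)%N -> (h ^+ n) m = 0.
Proof.
move=> h0; elim: n => // n IH m mn; rewrite exprS.
have h_low : forall i, (i < 1)%N -> h i = 0 by case.
by apply: (fpsM_low h_low IH).1.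
Qed.

Lemma fpsXnM (K : comNzRingType) d (w : fps K) m :
  (fps_poly 'X^d * w) m = shiftS d w m.
Proof.
have X_low : forall i, (i < d)%N -> fps_poly ('X^d : {poly K}) i = 0.
  by move=> i id; rewrite /= coefXn ltn_eqF.
rewrite /shiftS; case: leqP => [dm|md]; last first.
  have w_low : forall i, (i < 0)%N -> w i = 0 by [].
  by apply: (fpsM_low X_low w_low).1; rewrite addn0.
have dm1 : (d < m.+1)%N by [].
rewrite fpsME (bigD1 (Ordinal dm1)) //= coefXn eqxx mul1r big1 ?addr0 // => i.
by rewrite -val_eqE /= coefXn => /negPf ->; rewrite mul0r.
Qed.

Section Substitution.
Variables (R : realType) (u : ser2 R) (PP T : {poly (fps R[i])}).
Hypothesis PPE : toS2 idfun PP = mulS u (toS2 idfun T).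

(** The unit may contain infinitely many powers of y and so need not be a polynomial in y; up to y^N
    a truncation does the same work. *)
Lemma toS2_trunc N n m : (n <= N)%N ->
  PP`_n m = ((\poly_(j < N.+1) Fps (fun i => u i j)) * T)`_n m.
Proof.
move=> nN; set U := \poly_(j < _) _.
have -> : PP`_n m = mulS u (toS2 idfun T) m n by rewrite -PPE.
have -> : (U * T)`_n m = toS2 idfun (U * T) m n by [].
rewrite toS2M /mulS; apply: eq_bigr => i _; apply: eq_bigr => j _; congr (_ * _).
by rewrite /toS2 coef_poly ltnS (leq_trans _ nN) // -ltnS.
Qed.

(** The truncation error is divisible by y^(N+1) and [h] has no constant term, so after substitution
    the error starts beyond x^N. *)
Lemma subst_lowest (h : fps R[i]) N : h 0%N = 0 ->
  (forall m, (m < N)%N -> T.[h] m = 0) ->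
  (forall m, (m < N)%N -> PP.[h] m = 0) /\ PP.[h] N = u 0%N 0%N * T.[h] N.
Proof.
move=> h0 T_low; set U := \poly_(j < N.+1) Fps (fun i => u i j).
have h_low : forall i, (i < 1)%N -> h i = 0 by case.
have diff m : (m < N.+1)%N -> PP.[h] m = (U.[h] * T.[h]) m.
  move=> mN; apply/eqP; rewrite -subr_eq0 -fpsBE -hornerM -hornerN -hornerD.
  rewrite -(poly_take_drop N.+1 (PP - U * T)).
  have -> : take_poly N.+1 (PP - U * T) = 0.
    apply/polyP => n; rewrite coef_poly coef0; case: ltnP => // nN.
    by apply: fpsP => i; rewrite coefB fpsBE (@toS2_trunc N) ?subrr.
  rewrite add0r hornerM hornerXn mulrC.
  have e_low : forall i, (i < 0)%N -> (drop_poly N.+1 (PP - U * T)).[h] i = 0 by [].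
  by apply/eqP; apply: (fpsM_low (fps_exp_low h0) e_low).1; rewrite addn0.
have U0 : U.[h] 0%N = u 0%N 0%N.
  have [e /(congr1 (fun f : fps _ => f 0%N))] := horner_diff U h 0.
  rewrite subr0 fpsBE horner_coef0 coef_poly fpsME big_ord_recl big_ord0 h0 mul0r addr0 /=.
  by move/eqP; rewrite subr_eq0 => /eqP.
have U_low : forall i, (i < 0)%N -> U.[h] i = 0 by [].
have [low lead] := fpsM_low U_low T_low; rewrite add0n U0 in low lead.
by split=> [m mN|]; rewrite diff ?lead ?low // ltnW.
Qed.

End Substitution.

Lemma poly_eq0_horner (R : numDomainType) (p : {poly R}) : (forall z, p.[z] = 0) -> p = 0.
Proof.
move=> p0; apply: (@roots_geq_poly_eq0 _ p [seq n%:R | n <- iota 0 (size p)]).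
- by apply/allP => z _; apply/rootP.
- by rewrite map_inj_uniq ?iota_uniq //; move=> m n /eqP; rewrite eqr_nat => /eqP.
- by rewrite size_map size_iota.
Qed.

(** Substituting y = - q - w x^d and dividing by x^N leaves a polynomial in w that reduces to [r] at
    x = 0, so [hensel] applies. The coefficients are identified from their values at all real
    [z]. *)
Lemma lift_root (R : realType) (P : {poly {poly R}}) (q : {poly R}) d N (r : {poly R}) z0 :
  (forall z m, (m < N)%N -> P.[- q - z *: 'X^d]`_m = 0) ->
  (forall z, P.[- q - z *: 'X^d]`_N = r.[z]) ->
  r.[z0] = 0 -> r^`().[z0] != 0 ->
  exists2 w : fps R, w \in convfps & w 0%N = z0 /\
    (map_poly (@fps_poly R) P).[- fps_poly q - fps_poly 'X^d * w] = 0.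
Proof.
move=> P_low P_lead rz rz'.
pose Q := P \Po ((- q)%:P - ('X^d)%:P * 'X).
have QE z m : ((swapXY Q)`_m).[z] = P.[- q - z *: 'X^d]`_m.
  have := congr1 (fun p : {poly R} => p`_m) (horner_polyC Q z).
  rewrite coef_map /= /horner_eval => <-; rewrite /Q horner_comp !hornerE.
  by rewrite -[_ * z%:P]mulrC mul_polyC.
have Q_low n m : (m < N)%N -> Q`_n`_m = 0.
  move=> mN; rewrite -coef_swapXY.
  by rewrite (poly_eq0_horner (fun z => etrans (QE z m) (P_low z m mN))) coef0.
have Q_lead n : Q`_n`_N = r`_n.
  rewrite -coef_swapXY; suff -> : (swapXY Q)`_N = r by [].
  apply/eqP; rewrite -subr_eq0; apply/eqP.
  by apply: poly_eq0_horner => z; rewrite hornerD hornerN QE P_lead subrr.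
pose Q' := \poly_(n < size Q) drop_poly N Q`_n.
have Q'E n : Q'`_n = drop_poly N Q`_n.
  by rewrite coef_poly; case: ltnP => // nQ; rewrite nth_default // drop_poly0r.
have QQ' : Q = Q' * ('X^N)%:P.
  apply/polyP => n; rewrite coefMC Q'E -{1}(poly_take_drop N Q`_n).
  rewrite [take_poly _ _](_ : _ = 0) ?add0r //; apply/polyP => m.
  by rewrite coef_poly coef0; case: ltnP => // /Q_low.
have rE n : r`_n = Q'`_n`_0 by rewrite Q'E coef_drop_poly add0n Q_lead.
have [w wconv [w0 wroot]] := hensel rE rz rz'.
exists w => //; split=> //.
have : (map_poly (@fps_poly R) Q).[w] = 0 by rewrite QQ' rmorphM hornerM wroot mul0r.
rewrite /Q map_comp_poly horner_comp rmorphB rmorphM /= !map_polyC map_polyX !hornerE.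
by rewrite -(rmorphN (@fps_poly R)).
Qed.

(** The minimum property in a form that covers equal and distinct [q] uniformly. *)
Lemma OijP (R : realType) (qi qj : {poly R}) Li Lj (O := Oij qi qj Li Lj) :
  [/\ (O <= 2 * Li)%N, (O <= 2 * Lj)%N,
      forall m, (m < O)%N -> (qj - qi)`_m = 0 &
      (O < 2 * Li)%N -> (O < 2 * Lj)%N -> (qj - qi)`_O != 0].
Proof.
rewrite {}/O /Oij; case: eqP => [->|/eqP q0].
  by split; [lia|lia|move=> m _; rewrite coef0|lia].
set o := ordp _; have o_nz : (qj - qi)`_o != 0.
  apply: (@nth_find _ 0 (fun c => c != 0)); rewrite has_find /=.
  apply: contraLR q0; rewrite -leqNgt negbK => o_ge.
  apply/eqP/polyP => n; rewrite coef0; case: (ltnP n (size (qj - qi))) => [n_lt|]; last first.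
    by move=> ?; rewrite nth_default.
  by have := @before_find _ 0 (fun c => c != 0) (qj - qi) n (leq_trans n_lt o_ge) => /negbFE/eqP.
split; [lia|lia| |].
  move=> m m_lt; have : (m < o)%N by lia.
  by move=> /(@before_find _ 0 (fun c => c != 0)) /negbFE/eqP.
by move=> oi oj; have -> : minn o (minn (2 * Lj) (2 * Li)) = o by lia.
Qed.

(** * The leading form along one branch *)

Definition fps_coef0 (K : comNzRingType) (f : fps K) : K := f 0%N.

Fact fps_coef0_is_zmod_morphism (K : comNzRingType) : zmod_morphism (@fps_coef0 K).
Proof. by []. Qed.
Fact fps_coef0_is_monoid_morphism (K : comNzRingType) : monoid_morphism (@fps_coef0 K).
Proof. by split=> // f g; rewrite /fps_coef0 fpsME big_ord_recl big_ord0 addr0. Qed.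
HB.instance Definition _ (K : comNzRingType) :=
  GRing.isZmodMorphism.Build (fps K) K (@fps_coef0 K) (@fps_coef0_is_zmod_morphism K).
HB.instance Definition _ (K : comNzRingType) :=
  GRing.isMonoidMorphism.Build (fps K) K (@fps_coef0 K) (@fps_coef0_is_monoid_morphism K).

Section BranchData.
Variables (R : realType) (M : nat) (L : 'I_M -> nat) (q : 'I_M -> {poly R}) (i : 'I_M).
Local Notation O := (fun j => Oij (q i) (q j) (L i) (L j)).

Definition same_data : pred 'I_M := fun j => (q j == q i) && (L j == L i).
(** Under the degree bound these are the [j] with [L i < L j] for which [q j] agrees with [q i]
    below degree [2 * L i]; [branch_shift] is then the next coefficient of [q j]. *)
Definition deeper : pred 'I_M := fun j => ~~ same_data j && (O j == 2 * L i)%N.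
Definition branch_shift j : R := (q j - q i)`_(2 * L i).

Lemma same_dataP j : same_data j -> O j = (2 * L i)%N /\ O j = (2 * L j)%N.
Proof. by rewrite /same_data /Oij => /andP[/eqP -> /eqP ->]; rewrite subrr eqxx; lia. Qed.

Hypothesis size_q : forall j, (size (q j) <= 2 * L j)%N.

Lemma Oij_same j : O j = (2 * L i)%N -> O j = (2 * L j)%N -> same_data j.
Proof.
move=> Oi Oj; have LL : L j = L i by lia.
rewrite /same_data LL eqxx andbT -subr_eq0; apply/eqP/polyP => m; rewrite coef0.
have [_ _ low _] := OijP (q i) (q j) (L i) (L j).
case: (ltnP m (2 * L i)) => [|mL]; first by rewrite -Oi; exact: low.
rewrite coefB !nth_default ?subrr //; apply: leq_trans mL; rewrite ?size_q //.
by rewrite -LL size_q.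
Qed.

End BranchData.

Section Branches.
Variables (R : realType) (P : {poly {poly R[i]}}) (M k : nat) (u : ser2 R).
Variables (L : 'I_M -> nat) (q : 'I_M -> {poly R}) (psi : 'I_M -> ser1 R[i]).
Local Notation C := R[i].
Local Notation toC := (real_complex R).
Hypotheses (k_gt0 : (0 < k)%N) (u0 : u 0%N 0%N != 0).
Hypothesis q0 : forall j, (q j).[0] = 0.
Hypothesis size_q : forall j, (size (q j) <= 2 * L j)%N.
Hypothesis psi_upper : forall j, 0 < complex.Im (psi j 0%N).
Hypothesis P_low : forall n, (n < M)%N -> (P`_n).[0] = 0.
Hypothesis Pfact : substk2 k (polyS2 P) =
    mulS (substk2 k u)
      (\big[@mulS R/oneS R]_(j < M)
          lin1 (addS1 (substk1 k (polyS1 (q j))) (shiftS (2 * L j * k) (psi j)))).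

(** Replacing x by x^k clears the fractional powers, so the factors become genuine series. *)
Let hj j : fps C :=
  Fps (addS1 (substk1 k (polyS1 (q j))) (shiftS (2 * L j * k) (psi j))).
Let T : {poly (fps C)} := \prod_j ('X + (hj j)%:P).
Let PP : {poly (fps C)} :=
  map_poly (@fps_poly C) (map_poly (comp_poly 'X^k) P).

Lemma toS2_PP : toS2 idfun PP = mulS (substk2 k u) (toS2 idfun T).
Proof.
rewrite /T toS2_prod -Pfact; apply/funext => m; apply/funext => n.
by rewrite /toS2 /PP /substk2 /polyS2 !coef_map /= coef_comp_poly_Xn.
Qed.

(** At x = 0, y^M divides P and is coprime to the unit, so it divides the product of the M linear
    factors, whose constant terms therefore vanish. With [L j = 0] such a term would be [psi j 0],
    which is not real. *)
Lemma L_gt0 j : (0 < L j)%N.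
Proof.
pose U0 := map_poly (@fps_coef0 C) (\poly_(j < M.+1) Fps (fun i => substk2 k u i j)).
pose T0 := map_poly (@fps_coef0 C) T.
have T0E : T0 = \prod_(c <- [seq - hj j 0%N | j <- enum 'I_M]) ('X - c%:P).
  rewrite /T0 /T rmorph_prod big_map big_enum; apply: eq_bigr => i _.
  by rewrite rmorphD /= map_polyX map_polyC /= rmorphN opprK.
have UT_low : ('X^M %| U0 * T0)%R.
  rewrite -(poly_take_drop M (U0 * T0)) [take_poly _ _](_ : _ = 0) ?add0r ?dvdp_mulIr //.
  apply/polyP => n; rewrite coef_poly coef0; case: ltnP => // nM.
  rewrite -rmorphM /= coef_map /= /fps_coef0 -(toS2_trunc toS2_PP) ?(ltnW nM) //.
  rewrite /PP !coef_map /= coef_comp_poly_Xn // dvdn0 div0n -horner_coef0.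
  exact: P_low.
have U00 : U0.[0] != 0.
  by rewrite horner_coef0 coef_map /= coef_poly /fps_coef0 /= /substk2 dvdn0 div0n.
have cop : coprimep 'X^M U0.
  by rewrite coprimep_expl // -['X]subr0 -polyC0 coprimep_sym coprimep_XsubC rootE.
rewrite Gauss_dvdpr // in UT_low.
have sz : size ('X^M : {poly C}) == size T0.
  by rewrite T0E size_polyXn size_prod_XsubC size_map -cardE card_ord.
have : root T0 (- hj j 0%N) by rewrite T0E root_prod_XsubC; apply/mapP; exists j; rewrite ?mem_enum.
rewrite -(eqp_root (_ : 'X^M %= T0)); last by rewrite -dvdp_size_eqp.
rewrite rootE hornerXn expf_eq0 oppr_eq0 => /andP[_ /eqP].
rewrite /= /addS1 /substk1 dvdn0 div0n /polyS1 -horner_coef0 q0 add0r /shiftS.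
case: (L j) => // ; rewrite muln0 mul0n /= => p0.
by have := psi_upper j; rewrite p0 ltxx.
Qed.

Section OneBranch.
Variable i : 'I_M.
Local Notation O := (fun j => Oij (q i) (q j) (L i) (L j)).
Local Notation same_data := (same_data L q i).
Local Notation deeper := (deeper L q i).
Local Notation branch_shift := (branch_shift L q i).
Let N := (\sum_j O j)%N.

(* Lowest coefficient, that of [x^(O j)], of the [j]-th factor of [P] along
   [y = - q i - z x^(2 L i)]. *)
Definition lowest j (z : R) : C := ((q j - q i)`_(O j))%:C%C
  - (if O j == (2 * L i)%N then z%:C%C else 0)
  + (if O j == (2 * L j)%N then psi j 0%N else 0).

Lemma lowest_same j z : same_data j -> lowest j z = psi j 0%N - z%:C%C.
Proof.
move=> Sj; have [Oi Oj] := same_dataP Sj; rewrite /lowest -Oj -Oi eqxx.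
by case/andP: Sj => /eqP -> _; rewrite subrr coef0 rmorph0 add0r addrC.
Qed.

Lemma lowest_deeper j z : deeper j -> lowest j z = ((branch_shift j - z)%:C)%C.
Proof.
case/andP=> nS /eqP Oi; rewrite /lowest Oi eqxx ifN ?addr0 ?rmorphB //.
by apply: contra nS => /eqP Oj; apply: (Oij_same size_q); rewrite Oi.
Qed.

(** Here [O j] is below [2 * L i], so [z] does not enter. The constant has positive imaginary part
    if [O j] is [2 * L j], and otherwise is the lowest coefficient of [q j - q i]. *)
Lemma lowest_other j z : ~~ same_data j -> ~~ deeper j ->
  lowest j z = lowest j 0 /\ lowest j 0 != 0.
Proof.
move=> nS; rewrite /deeper nS /= => Oi; rewrite /lowest (negPf Oi); split=> //.
have [Oi' Oj' _ lead] := OijP (q i) (q j) (L i) (L j).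
have [_|Oj] := eqVneq (Oij (q i) (q j) (L i) (L j)) (2 * L j)%N.
  have := psi_upper j; case: (psi j 0%N) => a b /= b0.
  by rewrite eq_complex /= negb_and oppr0 !add0r (gt_eqF b0) orbT.
by rewrite subr0 addr0 fmorph_eq0; apply: lead; rewrite ltn_neqAle ?Oi ?Oj.
Qed.

Let hz (z : R) : {poly R} := - q i - z *: 'X^(2 * L i).

Lemma branch_expansion z :
  (forall m, (m < N)%N -> (P.[map_poly toC (hz z)])`_m = 0) /\
  (P.[map_poly toC (hz z)])`_N = u 0%N 0%N * \prod_j lowest j z.
Proof.
pose h : fps C := fps_poly (map_poly toC (hz z) \Po 'X^k).
have PPh : PP.[h] = fps_poly (P.[map_poly toC (hz z)] \Po 'X^k).
  by rewrite /PP /h horner_map; congr fps_poly; exact: (horner_map (comp_poly 'X^k)).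
have hE m : h m = if (k %| m)%N then ((hz z)`_(m %/ k))%:C%C else 0.
  by rewrite /= coef_comp_poly_Xn // coef_map.
have hh j m : (h + hj j) m = (if (k %| m)%N then
    (((q j - q i)`_(m %/ k))%:C%C - (if (m %/ k == 2 * L i)%N then z%:C%C else 0))
    else 0) + shiftS (2 * L j * k) (psi j) m.
  rewrite fpsDE hE /= /addS1 /substk1 /polyS1 addrA; congr (_ + _).
  case: ifP => _; last by rewrite addr0.
  rewrite /hz !coefB coefN coefZ coefXn.
  by case: eqP => _; rewrite ?mulr1 ?mulr0 !rmorphB rmorphN ?rmorph0; ring.
have hh_low j m : (m < k * O j)%N -> (h + hj j) m = 0.
  have [Oi Oj low _] := OijP (q i) (q j) (L i) (L j).
  move=> mO; rewrite hh /shiftS.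
  have mk : (m %/ k < O j)%N by rewrite ltn_divLR // mulnC.
  rewrite low // (ltn_eqF (leq_trans mk Oi)) rmorph0 subr0 if_same add0r ifN //.
  by rewrite -ltnNge; apply: leq_trans mO _; rewrite mulnC leq_pmul2r.
have hh_lead j : (h + hj j) (k * O j)%N = lowest j z.
  rewrite hh dvdn_mulr // mulKn // /lowest; congr (_ + _); rewrite /shiftS [(k * _)%N]mulnC.
  have [_ Oj _ _] := OijP (q i) (q j) (L i) (L j).
  rewrite leq_pmul2r // eqn_leq Oj /=; case: leqP => // Oj'.
  have -> : Oij (q i) (q j) (L i) (L j) = (2 * L j)%N by lia.
  by rewrite subnn.
have [Tlow Tlead] := fps_prod_low hh_low.
have TE : T.[h] = \prod_j (h + hj j).
  by rewrite /T horner_prod; apply: eq_bigr => j _; rewrite !hornerE.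
rewrite -TE -big_distrr /= -/N in Tlow Tlead.
(* Positivity of [L i] keeps [z] out of the constant term. *)
have h0 : h 0%N = 0.
  rewrite hE dvdn0 div0n /hz coefB coefN coefZ coefXn -horner_coef0 q0 oppr0.
  by have := L_gt0 i; case: (L i) => // l _; rewrite mulnS mulr0 subr0 rmorph0.
have [low lead] := subst_lowest toS2_PP h0 Tlow.
have PPhE m : PP.[h] (k * m)%N = (P.[map_poly toC (hz z)])`_m.
  by rewrite PPh /= coef_comp_poly_Xn // dvdn_mulr // mulKn.
split=> [m mN|]; first by rewrite -PPhE low // ltn_pmul2l.
rewrite -PPhE lead Tlead /substk2 dvdn0 div0n; congr (_ * _).
by apply: eq_bigr => j _; exact: hh_lead.
Qed.

(** Together with [branch_upper] and [branch_real], this gives the constant c, the roots of H and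
    the real-rooted g of the leading form c H g. *)
Definition branch_const : C :=
  u 0%N 0%N * \prod_(j | ~~ same_data j && ~~ deeper j) lowest j 0.
Definition branch_upper : seq C := [seq psi j 0%N | j <- enum same_data].
Definition branch_real : {poly R} := \prod_(j | deeper j) ((branch_shift j)%:P - 'X).

Lemma branch_const_neq0 : branch_const != 0.
Proof.
rewrite mulf_neq0 // prodf_seq_neq0; apply/allP => j _; apply/implyP => /andP[nS nD].
by have [] := lowest_other 0 nS nD.
Qed.

Lemma prod_lowest z : u 0%N 0%N * \prod_j lowest j z =
  (branch_const *: hbpoly branch_upper).[(z%:C)%C] * ((branch_real.[z])%:C)%C.
Proof.
rewrite (bigID same_data) /= (bigID deeper (fun j => ~~ same_data j)) /=.
rewrite hornerZ /branch_const /hbpoly /branch_upper big_map big_enum /=.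
have -> : \prod_(j | same_data j) lowest j z =
    (\prod_(j in same_data) ((psi j 0%N)%:P - 'X)).[(z%:C)%C].
  by rewrite horner_prod; apply: eq_bigr => j Sj; rewrite !hornerE lowest_same.
have -> : \prod_(j | ~~ same_data j && deeper j) lowest j z = ((branch_real.[z])%:C)%C.
  rewrite horner_prod rmorph_prod; apply: eq_big => [j|j /andP[_ Dj]].
    by rewrite /deeper andbA andbb.
  by rewrite lowest_deeper // !hornerE.
have -> : \prod_(j | ~~ same_data j && ~~ deeper j) lowest j z =
    \prod_(j | ~~ same_data j && ~~ deeper j) lowest j 0.
  by apply: eq_bigr => j /andP[nS nD]; have [-> _] := lowest_other z nS nD.
ring.
Qed.

Lemma branch_upperP : all (fun a => 0 < complex.Im a) branch_upper.
Proof. by apply/allP => _ /mapP[j _ ->]. Qed.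

Variable t : R.
Hypothesis t_lead : pencil t branch_const != 0.
Hypothesis t_sep : forall j,
  pencil t (branch_const * (hbpoly branch_upper).[((branch_shift j)%:C)%C]) != 0.
Let PR : {poly {poly R}} := map_poly (map_poly (pencil t)) P.

(** [t_lead] preserves the number of roots of the first factor, and [t_sep] keeps them off those of
    [branch_real], so they stay simple in the product and lift. *)
Lemma branch_roots : exists l : seq R, [/\ uniq l, size l = #|same_data| &
  forall z, z \in l ->
    (exists2 w : fps R, w \in convfps & w 0%N = z /\
      (map_poly (@fps_poly R) PR).[- fps_poly (q i) - fps_poly 'X^(2 * L i) * w] = 0) /\
    (forall j, deeper j -> z != branch_shift j)].
Proof.
have [l [l_uniq l_size l_root]] := hermite_biehler branch_upperP t_lead.
set hp := map_poly _ _ in l_root.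
exists l; split=> //; first by rewrite l_size size_map -cardE.
move=> z zl; have [z_root z_simple] := l_root z zl.
have z_sep j : z != branch_shift j.
  apply: contraNneq (t_sep j) => <-.
  by rewrite -hornerZ -horner_map_pencil z_root.
split=> //; have gz : branch_real.[z] != 0.
  rewrite horner_prod prodf_seq_neq0; apply/allP => j _; apply/implyP => _.
  by rewrite !hornerE subr_eq0 eq_sym.
apply: (@lift_root _ PR (q i) (2 * L i) N (hp * branch_real)).
- move=> x m mN; rewrite horner_map2_pencil coef_map.
  by rewrite (branch_expansion x).1 // raddf0.
- move=> x; rewrite horner_map2_pencil coef_map.
  by rewrite (branch_expansion x).2 prod_lowest /= pencilMr hornerM horner_map_pencil.
- by rewrite hornerM z_root mul0r.
- by rewrite derivM hornerD !hornerM z_root mul0r addr0 mulf_neq0.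
Qed.

End OneBranch.
End Branches.

(** * Assembling the branches *)

(** The only [t] at which the pencil can kill a nonzero [w]. For real [w] the quotient is 0 by
    convention, harmlessly: the pencil then returns [w]. *)
Definition pencil_zero (R : realType) (w : R[i]) : R := - complex.Re w / complex.Im w.

Lemma pencil_neq0 (R : realType) (t : R) (w : R[i]) :
  w != 0 -> t != pencil_zero w -> pencil t w != 0.
Proof.
case: w => a b w0 tw; apply/eqP => /pencil_eq0P /= ab.
have b0 : b != 0.
  by apply: contraNneq w0 => b0; rewrite ab b0 mulr0 oppr0; exact/eqP.
by move: tw; rewrite /pencil_zero /= ab opprK mulfK // eqxx.
Qed.

Lemma pencil_poly (R : realType) (P : {poly {poly R[i]}}) (t : R) m n :
  (Apart P + cstP ((t%:C)%C) * Bpart P)`_n`_m = ((pencil t P`_n`_m)%:C)%C.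
Proof.
by rewrite /Apart /Bpart /cstP !(coefD, coefCM, coefN) /conjP !coef_map /= pencilE.
Qed.

Section ClassIndex.
Variables (I : finType) (A : Type) (e : rel I).
Hypothesis e_equiv : equivalence_rel e.

(* A family of lists, one per class, is read off uniformly by taking the list of
   a canonical representative of the class. *)
Lemma class_index (l : I -> seq A) :
  (forall i, size (l i) = #|e i|) ->
  exists (rep : I -> I) (pos : I -> nat),
    [/\ forall i, e i (rep i), forall i, (pos i < size (l (rep i)))%N &
        forall i j, i != j -> e i j -> rep i = rep j /\ pos i != pos j].
Proof.
move=> l_size; have e_refl i : e i i by have [] := e_equiv i i i.
have eE i j : e i j -> e i =1 e j by move=> eij x; have [_ /(_ eij)] := e_equiv i j x.
(* Equivalent elements define the same predicate, hence the same pick; the default is never reached,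
   [e] being reflexive. *)
pose rep i := odflt i [pick j | e i j].
have e_rep i : e i (rep i).
  by rewrite /rep; case: pickP => //= /(_ i); rewrite e_refl.
exists rep, (fun i => index i (enum (e i))); split=> //.
- move=> i; rewrite l_size -(eq_card (eE _ _ (e_rep i))) cardE index_mem mem_enum.
  exact: e_refl.
- move=> i j ij eij; split.
    rewrite /rep (eq_pick (eE _ _ eij)); case: pickP => //= /(_ j).
    by rewrite e_refl.
  rewrite -(eq_enum (eE _ _ eij)); apply: contra ij => /eqP ij.
  have mem_ij x : x \in [:: i; j] -> x \in enum (e i).
    by rewrite mem_enum !inE => /orP[] /eqP ->; [exact: e_refl|exact: eij].
  apply/eqP; rewrite -(nth_index i (mem_ij i _)) ?mem_head // {1}ij nth_index //.
  by rewrite mem_ij // !inE eqxx orbT.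
Qed.
End ClassIndex.

Lemma OijC (R : realType) (p r : {poly R}) a b : Oij p r a b = Oij r p b a.
Proof.
suff le (p' r' : {poly R}) a' b' : (Oij p' r' a' b' <= Oij r' p' b' a')%N.
  by apply/eqP; rewrite eqn_leq !le.
have [Oa Ob low _] := OijP p' r' a' b'; have [_ _ _ lead] := OijP r' p' b' a'.
rewrite leqNgt; apply/negP => lt.
have := lead (leq_trans lt Ob) (leq_trans lt Oa).
by rewrite -opprB coefN oppr_eq0 low ?eqxx.
Qed.

Section Assembly.
Variables (R : realType) (M : nat) (L : 'I_M -> nat) (q : 'I_M -> {poly R}).
Variables (w : 'I_M -> fps R).
Hypothesis w_same : forall i j, i != j -> same_data L q i j -> w i 0%N != w j 0%N.
Hypothesis w_deeper : forall i j, deeper L q i j -> w i 0%N != branch_shift L q i j.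
Hypothesis size_q : forall j, (size (q j) <= 2 * L j)%N.

(** Four cases, by which of [2 * L i] and [2 * L j] the order attains. If both, the constants of [w]
    differ by [w_same]; if one, [w_deeper] separates a constant from a shift; if none, [q j - q i]
    supplies the coefficient. *)
Lemma branch_order i j : i != j ->
  has_order (fun m => (q j - q i)`_m + shiftS (2 * L j) (w j) m
                        - shiftS (2 * L i) (w i) m)
            (Oij (q i) (q j) (L i) (L j)).
Proof.
move=> ij; have [Oi Oj low lead] := OijP (q i) (q j) (L i) (L j).
split=> [m mO|]; rewrite /shiftS.
  by rewrite low // !ifN ?addr0 ?subr0 // -ltnNge; apply: leq_trans mO _.
have Obool (a b : nat) (A : Type) (x y : A) : (a <= b)%N ->
    (if (b <= a)%N then x else y) = if a == b then x else y.
  by move=> ab; rewrite eqn_leq ab.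
rewrite !Obool //.
have [Sij|nS] := boolP (same_data L q i j).
  have [Oi' Oj'] := same_dataP Sij; rewrite -Oj' -Oi' !eqxx !subnn.
  have /andP[/eqP -> _] := Sij; rewrite subrr coef0 add0r subr_eq0.
  by rewrite eq_sym w_same.
have [/eqP Oi'|Oi'] := boolP (Oij (q i) (q j) (L i) (L j) == 2 * L i)%N.
  rewrite Oi' subnn; have [Oj'|_] := eqVneq (2 * L i)%N (2 * L j)%N.
    by case/negP: nS; apply: (Oij_same size_q); rewrite Oi'.
  by rewrite addr0 subr_eq0 eq_sym; apply: w_deeper; rewrite /deeper nS Oi' eqxx.
have [/eqP Oj'|Oj'] := boolP (Oij (q i) (q j) (L i) (L j) == 2 * L j)%N.
  rewrite Oj' subnn subr0 -[(q j - q i)`_ _]opprK -coefN opprB addrC subr_eq0.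
  apply: (@w_deeper j i); rewrite /deeper OijC Oj' eqxx andbT.
  by apply: contra nS; rewrite /same_data eq_sym [L i == _]eq_sym.
by rewrite addr0 subr0; apply: lead; rewrite ltn_neqAle ?Oi' ?Oj'.
Qed.

End Assembly.

Theorem theorem3p5 (R : realType) (P : {poly {poly R[i]}}) (M k : nat)
    (u : ser2 R) (L : 'I_M -> nat) (q : 'I_M -> {poly R})
    (psi : 'I_M -> ser1 R[i]) :
  (* P has no zeros in R x H *)
  (forall (a : R) (b : R[i]), 0 < complex.Im b -> eval2 P ((a%:C)%C) b != 0) ->
  (* P and \bar P have no common (non-unit) factor *)
  (forall Q S1 S2 : {poly {poly R[i]}},
      P = Q * S1 -> conjP P = Q * S2 -> exists c : R[i], Q = cstP c) ->
  (* M = Ord P(0,y) *)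
  has_order (fun n => (P`_n).[0]) M ->
  (* normalization: the coefficient of y^M in P(0,y) is real *)
  complex.Im ((P`_M)`_0) = 0 ->
  (* the factorization data of the context *)
  (0 < k)%N ->
  unit2 u ->
  (forall j, (q j).[0] = 0) ->
  (forall j, (size (q j) <= 2 * L j)%N) ->
  (forall j, conv1 (psi j) /\ 0 < complex.Im (psi j 0%N)) ->
  (* P(s^k,y) = u(s^k,y) prod_j (y + q_j(s^k) + s^(2 L_j k) psi_j(s)) *)
  substk2 k (polyS2 P) =
    mulS (substk2 k u)
      (\big[@mulS R/oneS R]_(j < M)
          lin1 (addS1 (substk1 k (polyS1 (q j))) (shiftS (2 * L j * k) (psi j)))) ->
  exists F : seq R, forall t : R, t \notin F ->
    exists (ut : ser2 R) (psit : 'I_M -> ser1 R),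
      [/\ unit2 ut,
          (forall j, conv1R (psit j)),
          polyS2 (Apart P + cstP ((t%:C)%C) * Bpart P) =
            mulS ut (\big[@mulS R/oneS R]_(j < M)
                       lin1 (addS1 (polyS1 (q j)) (realS (shiftS (2 * L j) (psit j))))) &
          forall i j : 'I_M, i != j ->
            has_order (fun m => (q j - q i)`_m + shiftS (2 * L j) (psit j) m
                                 - shiftS (2 * L i) (psit i) m)
                      (Oij (q i) (q j) (L i) (L j))].
Proof.
move=> _ _ [P_low P_lead] P_real k_gt0 [_ u0] q0 size_q psiP Pfact.
have psi_upper j : 0 < complex.Im (psi j 0%N) by have [] := psiP j.
pose c i := branch_const u L q psi i.
pose v i j := c i * (hbpoly (branch_upper L q psi i)).[((branch_shift L q i j)%:C)%C].
pose cz i := pencil_zero (c i).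
pose vz (ij : 'I_M * 'I_M) := pencil_zero (v ij.1 ij.2).
(* Each excluded [t] kills one of finitely many nonzero numbers: the constants c_i, or the values of
   c_i H_i at the shifts, nonzero because the shifts are real and the roots of H_i are not. *)
exists (codom cz ++ codom vz) => t.
rewrite mem_cat negb_or => /andP[tc tv].
have c_neq0 i : c i != 0 by exact: branch_const_neq0.
have t_lead i : pencil t (c i) != 0.
  by apply: pencil_neq0 => //; apply: contra tc => /eqP ->; exact: (codom_f cz).
have t_sep i j : pencil t (v i j) != 0.
  apply: pencil_neq0; first by rewrite mulf_neq0 // hbpoly_real_neq0 // branch_upperP.
  by apply: contra tv => /eqP ->; exact: (codom_f vz (i, j)).
pose PR : {poly {poly R}} := map_poly (map_poly (pencil t)) P.
have /choice[l lP] := fun i => branch_roots k_gt0 u0 q0 size_q psi_upper P_low Pfact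
  (t_lead i) (t_sep i).
have same_equiv : equivalence_rel (same_data L q).
  by move=> x y z; rewrite /same_data !eqxx; split=> // /andP[/eqP -> /eqP ->].
have l_size i : size (l i) = #|same_data L q i| by have [] := lP i.
have [rep [pos [rep_same pos_lt pos_inj]]] := class_index same_equiv l_size.
(* Indices with the same data receive different entries of one common list of roots. *)
pose zeta j := nth 0 (l (rep j)) (pos j).
have rep_data j : q (rep j) = q j /\ L (rep j) = L j.
  by have /andP[/eqP -> /eqP ->] := rep_same j.
have zetaP j : (exists w : fps R, [/\ w \in convfps, w 0%N = zeta j &
      (map_poly (@fps_poly R) PR).[- fps_poly (q j) - fps_poly 'X^(2 * L j) * w] = 0]) /\
    (forall j', deeper L q j j' -> zeta j != branch_shift L q j j').
  have [_ _ /(_ (zeta j))] := lP (rep j); rewrite /deeper /same_data /branch_shift.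
  have [-> ->] := rep_data j; rewrite mem_nth // => /(_ isT)[[w wc [w0 wr]] sep].
  by split=> //; exists w.
have /choice[w wP] := fun j => (zetaP j).1.
have w_conv j : w j \in convfps by have [] := wP j.
have w0 j : w j 0%N = zeta j by have [] := wP j.
have w_same i j : i != j -> same_data L q i j -> w i 0%N != w j 0%N.
  move=> ij Sij; have [rij pij] := pos_inj _ _ ij Sij.
  have [l_uniq _ _] := lP (rep i); rewrite !w0 /zeta -rij nth_uniq // rij; exact: pos_lt.
have w_deeper i j : deeper L q i j -> w i 0%N != branch_shift L q i j.
  by rewrite w0; exact: (zetaP i).2.
have orders := branch_order w_same w_deeper size_q.
pose y j : fps R := - fps_poly (q j) - fps_poly 'X^(2 * L j) * w j.
have yE j m : y j m = - (q j)`_m - shiftS (2 * L j) (w j) m.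
  by rewrite /y fpsBE fpsXnM.
have PR_conv : map_poly (@fps_poly R) PR \is a polyOver convfps.
  by apply/polyOverP => n; rewrite coef_map convfps_poly.
have y_conv j : y j \in convfps by rewrite rpredB ?rpredN ?rpredM ?convfps_poly.
have y_root j : (map_poly (@fps_poly R) PR).[y j] = 0 by have [] := wP j.
(* The contact orders just computed are finite, so the roots differ by regular series. *)
have y_reg i j : i != j -> forall g, (y i - y j) * g = 0 -> g = 0.
  move=> ij; have [low lead] := orders _ _ ij.
  have yijE m : (y i - y j) m = (q j - q i)`_m + shiftS (2 * L j) (w j) m
                                - shiftS (2 * L i) (w i) m.
    by rewrite fpsBE !yE coefB; ring.
  by apply: (@fps_lreg _ _ (Oij (q i) (q j) (L i) (L j))) => [m mO|];
    rewrite yijE; [exact: low|exact: lead].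
have [S S_conv PRE] := polyOver_factor_roots PR_conv y_conv y_root y_reg.
exists (toS2 (real_complex R) S), w; split=> //.
- have y0 j : fps_coef0 (y j) = 0.
    rewrite /fps_coef0 yE -horner_coef0 q0.
    have := L_gt0 k_gt0 u0 q0 psi_upper P_low Pfact j.
    by case: (L j) => // n _; rewrite /shiftS mulnS subr0 oppr0.
  split; first exact: conv2_toS2.
  rewrite /toS2 fmorph_eq0.
  (* At x = 0 the linear factors become y^M, so the constant term of the cofactor is the pencil of
     the coefficient of y^M in P(0,y). That coefficient is real and nonzero, hence unchanged by the
     pencil for every [t]. *)
  have := congr1 (fun p => (map_poly (@fps_coef0 R) p)`_M) PRE.
  rewrite rmorphM rmorph_prod /=.
  rewrite (eq_bigr (fun=> 'X)) => [|j _]; last first.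
    by rewrite rmorphB /= map_polyX map_polyC [X in _ - X%:P](y0 j) subr0.
  rewrite prodr_const card_ord coefMXn ltnn subnn !coef_map /= /fps_coef0 => <-.
  rewrite !coef_map /= /pencil P_real mulr0 addr0.
  move: P_lead P_real; rewrite horner_coef0; case: (_`_0) => a b.
  by rewrite eq_complex /= => ab b0; move: ab; rewrite b0 eqxx andbT.
- by move=> j; apply/asboolP; exact: w_conv.
- have -> : polyS2 (Apart P + cstP ((t%:C)%C) * Bpart P) =
      toS2 (real_complex R) (map_poly (@fps_poly R) PR).
    apply/funext => m; apply/funext => n.
    by rewrite /polyS2 pencil_poly /toS2 !coef_map /= !coef_map.
  rewrite PRE toS2M; congr mulS.
  rewrite (eq_bigr (fun j => 'X + (- y j)%:P)) => [|j _]; last by rewrite rmorphN.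
  rewrite toS2_prod; apply: eq_bigr => j _; congr lin1; apply/funext => m.
  by rewrite fpsNE yE opprD !opprK rmorphD.
Qed.
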